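(* Let $A\in\mathbb{R}^{N\times N}$ be symmetric positive-definite, let $\mathbf{b},\boldsymbol{\varphi}\in\mathbb{R}^N$, let $(\mathbf{u}^*,\boldsymbol{\lambda}^* )$ be the solution of $$A\mathbf{u}+\boldsymbol{\lambda}=\mathbf{b},\qquad \boldsymbol{\lambda}-(\boldsymbol{\lambda}+\mathbf{u}-\boldsymbol{\varphi})_+=\mathbf{0},$$ and let $(\mathbf{u}^k,\boldsymbol{\lambda}^k)$ be the $k$-th iterate of the HIK algorithm applied to this system, with predicted active and inactive sets $\mathcal{A}^k,\mathcal{I}^k$. Consider an iterate $k\ge 1$ such that $\mathcal{A}^*\subseteq\mathcal{A}^k$ and, consequently, $\mathcal{I}^k\subseteq\mathcal{I}^*$. Suppose moreover that $\mathbf{u}^k\le\boldsymbol{\varphi}$ (componentwise). Then $$\|\mathbf{u}^{k+1}-\mathbf{u}^*\|_A^2-\|\mathbf{u}^{k}-\mathbf{u}^*\|_A^2+\|\boldsymbol{\lambda}^k_{\mathcal{I}^k}\|^2_{(A_{\mathcal{I}^k,\mathcal{I}^k})^{-1}}=0,$$ and, if $\mathbf{u}^k\neq\mathbf{u}^*$, then $$\frac{\|\mathbf{u}^{k+1}-\mathbf{u}^*\|_A}{\|\mathbf{u}^{k}-\mathbf{u}^*\|_A}=\frac{\|\boldsymbol{\lambda}^{k+1}-\boldsymbol{\lambda}^*\|_{A^{-1}}}{\|\boldsymbol{\lambda}^{k}-\boldsymbol{\lambda}^*\|_{A^{-1}}}=\rho(\boldsymbol{\lambda}^k):=\left(1-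\frac{\|\boldsymbol{\lambda}^k_{\mathcal{I}^k}\|^2_{(A_{\mathcal{I}^k,\mathcal{I}^k})^{-1}}}{\|\boldsymbol{\lambda}^{k}-\boldsymbol{\lambda}^*\|^2_{A^{-1}}}\right)^{1/2}.$$
   Context: Notation: for a vector $\mathbf{v}$, $(\mathbf{v})_+$ is the componentwise maximum $\max(0,\mathbf{v}_i)$. For $\mathcal{U},\mathcal{Y}\subseteq\{1,\dots,N\}$, $B_{\mathcal{U},\mathcal{Y}}$ is the submatrix of $B$ with rows in $\mathcal{U}$ and columns in $\mathcal{Y}$, and $\mathbf{x}_{\mathcal{U}}$ is the subvector of $\mathbf{x}$ with indices in $\mathcal{U}$. For a symmetric positive-definite matrix $B$, $\|\mathbf{v}\|_B=(\mathbf{v}^\top B\mathbf{v})^{1/2}$ (equal to $0$ for the empty vector). HIK algorithm (primal-dual active set strategy with parameter $c=1$): $\mathbf{u}^0\in\mathbb{R}^N$ is given, $\boldsymbol{\lambda}^0=\mathbf{0}$, $\mathcal{A}^0=\emptyset$, $\mathcal{I}^0=\{1,\dots,N\}$. For $k\ge 0$, $(\mathbf{u}^{k+1},\boldsymbol{\lambda}^{k+1})$ is the unique pair satisfying $$A\mathbf{u}^{k+1}+\boldsymbol{\lambda}^{k+1}=\mathbf{b},\qquad \mathbf{u}^{k+1}_{\mathcal{A}^k}=\boldsymbol{\varphi}_{\mathcal{A}^k},\qquad \boldsymbol{\lambda}^{k+1}_{\mathcal{I}^k}=\mathbf{0},$$ and then $\mathcal{A}^{k+1}=\{i:\boldsymbol{\lambda}^{k+1}_i+\mathbf{u}^{k+1}_i-\boldsymbol{\varphi}_i>0\}$,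 $\mathcal{I}^{k+1}=\{1,\dots,N\}\setminus\mathcal{A}^{k+1}$. The sets at the solution are $\mathcal{A}^*=\{i:\boldsymbol{\lambda}^*_i+\mathbf{u}^*_i-\boldsymbol{\varphi}_i>0\}$ and $\mathcal{I}^*=\{1,\dots,N\}\setminus\mathcal{A}^*$. *)

(* Defs.v *)
From mathcomp Require Import all_boot all_order all_algebra.

Set Implicit Arguments.
Unset Strict Implicit.
Unset Printing Implicit Defensive.

Import Order.TTheory GRing.Theory Num.Theory.
Local Open Scope ring_scope.

Definition posdefmx (R : rcfType) (n : nat) (B : 'M[R]_n) : Prop :=
  B \is symmetricmx /\ forall v : 'cV[R]_n, v != 0 -> 0 < (v^T *m B *m v) 0 0.

(* Energy norm. Total in [B], but only meaningful when [posdefmx B]: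
   [Num.sqrt] is 0 on negative arguments. *)
Definition mxnorm (R : rcfType) (n : nat) (B : 'M[R]_n) (v : 'cV[R]_n) : R :=
  Num.sqrt ((v^T *m B *m v) 0 0).

(* [enum_val] lists an index set increasingly, so the order of rows and columns
   is the usual one. *)
Definition submat (R : rcfType) (n : nat) (B : 'M[R]_n) (U Y : {set 'I_n}) :
    'M[R]_(#|U|, #|Y|) :=
  mxsub (@enum_val _ (mem U)) (@enum_val _ (mem Y)) B.

Definition subvec (R : rcfType) (n : nat) (x : 'cV[R]_n) (U : {set 'I_n}) :
    'cV[R]_#|U| :=
  rowsub (@enum_val _ (mem U)) x.

Definition pospart (R : rcfType) (n : nat) (v : 'cV[R]_n) : 'cV[R]_n :=
  map_mx (Num.max 0) v.

Definition is_solution (R : rcfType) (n : nat) (A : 'M[R]_n)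
    (b phi u lam : 'cV[R]_n) : Prop :=
  A *m u + lam = b /\ lam - pospart (lam + u - phi) = 0.

Definition active_set (R : rcfType) (n : nat) (phi u lam : 'cV[R]_n) :
    {set 'I_n} :=
  [set i | 0 < lam i 0 + u i 0 - phi i 0].

(* [u], [lam], [act] are the sequences generated by the algorithm from [u0];
   the predicted inactive sets are the complements [~: act k]. For positive
   definite [A], the three equations at step [k] have a unique solution, so
   the sequences are determined by the data. *)
Record HIK (R : rcfType) (n : nat) (A : 'M[R]_n) (b phi u0 : 'cV[R]_n)
    (u lam : nat -> 'cV[R]_n) (act : nat -> {set 'I_n}) : Prop := {
  HIK_u0 : u 0%N = u0;
  HIK_lam0 : lam 0%N = 0;
  HIK_act0 : act 0%N = set0;
  HIK_eq : forall k, A *m u k.+1 + lam k.+1 = b;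
  HIK_eq_active : forall k, subvec (u k.+1) (act k) = subvec phi (act k);
  HIK_eq_inactive : forall k, subvec (lam k.+1) (~: act k) = 0;
  HIK_actS : forall k, act k.+1 = active_set phi (u k.+1) (lam k.+1)
}.

Definition rho (R : rcfType) (n : nat) (A : 'M[R]_n) (lams : 'cV[R]_n)
    (I : {set 'I_n}) (lam : 'cV[R]_n) : R :=
  Num.sqrt (1 - mxnorm (invmx (submat A I I)) (subvec lam I) ^+ 2
                / mxnorm (invmx A) (lam - lams) ^+ 2).

(* Main.v *)
Require Import Defs.
From mathcomp Require Import all_boot all_order all_algebra.
Import Order.TTheory GRing.Theory Num.Theory.
Local Open Scope ring_scope.

(** Write [I] for the predicted inactive set [~: act k], [d] for the step
    [u k.+1 - u k], and [e], [e'] for the errors [u k - us], [u k.+1 - us].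

    The bound [u k <= phi] makes the active sets decrease: an index
    outside [act k.-1] has [lam k i 0 = 0], so it can enter [act k] only if
    [u k i 0 > phi i 0].  Hence [u k], which equals [phi] on [act k.-1], equals
    it on [act k] ([HIK_u_on_act]).  So does [u k.+1] by construction, and [d]
    is supported on [I].  On the other hand
    [A *m e' = lams - lam k.+1] vanishes on [I]: [lam k.+1] does by
    construction, and [lams] does because [I] lies in the inactive set of the
    solution.  So [d] and [e'] are orthogonal for the inner product of [A], and
    Pythagoras applied to [e = e' - d] gives
    [mxnorm A e ^+ 2 = mxnorm A e' ^+ 2 + mxnorm A d ^+ 2].

    It remains to identify [mxnorm A d].  As [lam k.+1] vanishes on [I], the
    vector [A *m d = lam k - lam k.+1] has the same restriction to [I] as
    [lam k]; as [d] is supported on [I], that restriction determines [d] through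
    the principal submatrix of [A], and [mxnorm A d] is the norm of [lam k] on
    [I] in the inverse of that submatrix ([mxnorm_inv_submat]).

    The second part is a reformulation.  Since [lam j - lams = - A *m (u j - us)]
    for [j >= 1], the dual errors have the same norm as the primal ones
    ([mxnorm_inv_mulmx]), and the ratio follows by dividing the identity by
    [mxnorm A e ^+ 2]. *)

(** * Energy norms of positive definite matrices *)

Lemma posdefmx_trmx {R : rcfType} {n : nat} {B : 'M[R]_n} :
  posdefmx B -> B^T = B.
Proof.
case=> /is_hermitianmxP symB _.
by rewrite [RHS]symB expr0 scale1r map_mx_id.
Qed.

Lemma posdefmx_unitmx {R : rcfType} {n : nat} {B : 'M[R]_n} :
  posdefmx B -> B \in unitmx.
Proof.
case=> _ posB; rewrite -row_free_unit; apply: inj_row_free => v vB0.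
apply/eqP; apply: contraT => v_neq0.
have vT_neq0 : v^T != 0 by rewrite trmx_eq0.
by have := posB _ vT_neq0; rewrite trmxK vB0 mul0mx mxE ltxx.
Qed.

Lemma mxnorm_sqr {R : rcfType} {n : nat} {B : 'M[R]_n} (v : 'cV[R]_n) :
  posdefmx B -> mxnorm B v ^+ 2 = (v^T *m B *m v) 0 0.
Proof.
case=> _ posB; rewrite /mxnorm sqr_sqrtr //.
have [-> | v_neq0] := eqVneq v 0; first by rewrite mulmx0 mxE.
exact/ltW/posB.
Qed.

Lemma mxnorm_gt0 {R : rcfType} {n : nat} {B : 'M[R]_n} (v : 'cV[R]_n) :
  posdefmx B -> v != 0 -> 0 < mxnorm B v.
Proof. by case=> _ posB v_neq0; rewrite sqrtr_gt0 posB. Qed.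

Lemma mxnormN {R : rcfType} {n : nat} (B : 'M[R]_n) (v : 'cV[R]_n) :
  mxnorm B (- v) = mxnorm B v.
Proof. by rewrite /mxnorm [(- v)^T]linearN mulmxN !mulNmx opprK. Qed.

(** [B] is an isometry from its own energy norm to that of its inverse, by
    [(B v)^T B^-1 (B v) = v^T B v]. *)
Lemma mxnorm_inv_mulmx {R : rcfType} {n : nat} {B : 'M[R]_n} (v : 'cV[R]_n) :
  posdefmx B -> mxnorm (invmx B) (B *m v) = mxnorm B v.
Proof.
move=> pdB; rewrite /mxnorm trmx_mul (posdefmx_trmx pdB) -!mulmxA.
by rewrite mulKmx // posdefmx_unitmx.
Qed.

Lemma mxnorm_pythagoras {R : rcfType} {n : nat} {B : 'M[R]_n}
    (v w : 'cV[R]_n) :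
  posdefmx B -> v^T *m B *m w = 0 ->
  mxnorm B (w - v) ^+ 2 = mxnorm B w ^+ 2 + mxnorm B v ^+ 2.
Proof.
move=> pdB vBw0; rewrite !mxnorm_sqr //.
have wBv0 : w^T *m B *m v = 0.
  apply: trmx_inj; rewrite !trmx_mul trmxK (posdefmx_trmx pdB) mulmxA vBw0.
  by rewrite trmx0.
rewrite [(w - v)^T]linearB !(mulmxBl, mulmxBr) vBw0 wBv0 subr0 sub0r opprK.
by rewrite mxE.
Qed.

(** * Restriction to an index set *)

(** Restriction is encoded as a matrix so that its transpose, extension by zero,
    and principal submatrices can be computed with as matrix products. *)
Definition restrmx (R : rcfType) (n : nat) (U : {set 'I_n}) : 'M[R]_(#|U|, n) :=
  rowsub (@enum_val _ (mem U)) 1%:M.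
Arguments restrmx {R n} U.

Lemma subvecE {R : rcfType} {n : nat} (x : 'cV[R]_n) (U : {set 'I_n}) :
  subvec x U = restrmx U *m x.
Proof. exact: rowsubE. Qed.

Lemma submatE {R : rcfType} {n : nat} (B : 'M[R]_n) (U : {set 'I_n}) :
  submat B U U = restrmx U *m B *m (restrmx U)^T.
Proof.
rewrite -rowsubE; apply: trmx_inj.
by rewrite trmx_mul trmxK -rowsubE; apply/matrixP => i j; rewrite !mxE.
Qed.

Lemma mulmx_restrmx_tr {R : rcfType} {n : nat} (U : {set 'I_n}) :
  restrmx U *m (restrmx U)^T = 1%:M :> 'M[R]_#|U|.
Proof.
rewrite -rowsubE; apply/matrixP => i j.
by rewrite !mxE (inj_eq enum_val_inj) eq_sym.
Qed.

Lemma subvec_eqP {R : rcfType} {n : nat} (x y : 'cV[R]_n) (U : {set 'I_n}) :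
  reflect (forall i, i \in U -> x i 0 = y i 0) (subvec x U == subvec y U).
Proof.
apply: (iffP eqP) => [xyU i iU | xyU].
  by have /colP/(_ (enum_rank_in iU i)) := xyU; rewrite !mxE enum_rankK_in.
by apply/colP => j; rewrite !mxE xyU // enum_valP.
Qed.

Lemma restrmx_trK {R : rcfType} {n : nat} (U : {set 'I_n}) (d : 'cV[R]_n) :
  (forall i, i \notin U -> d i 0 = 0) -> (restrmx U)^T *m subvec d U = d.
Proof.
move=> suppd; apply/colP => i; rewrite mxE.
under eq_bigr do rewrite !mxE.
rewrite -(big_enum_val (fun j => (j == i)%:R * d j 0)) /=.
have [iU | iNU] := boolP (i \in U); last first.
  rewrite suppd // big1 // => j jU; case: eqP => [ji | _]; last by rewrite mul0r.
  by rewrite -ji jU in iNU.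
rewrite (bigD1 i) //= eqxx mul1r big1 ?addr0 // => j /andP[_ /negPf->].
by rewrite mul0r.
Qed.

Lemma posdefmx_submat {R : rcfType} {n : nat} {B : 'M[R]_n} (U : {set 'I_n}) :
  posdefmx B -> posdefmx (submat B U U).
Proof.
move=> pdB; split=> [|w w_neq0].
  apply/is_hermitianmxP; rewrite expr0 scale1r map_mx_id //.
  by rewrite submatE !trmx_mul trmxK (posdefmx_trmx pdB) mulmxA.
have Pw_neq0 : (restrmx U)^T *m w != 0.
  apply: contraNneq w_neq0 => Pw0.
  by rewrite -[w]mul1mx -(mulmx_restrmx_tr U) -mulmxA Pw0 mulmx0.
by have := pdB.2 _ Pw_neq0; rewrite submatE trmx_mul trmxK !mulmxA.
Qed.

(** For [d] supported on [U], the restriction of [B *m d] to [U] is the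
    principal submatrix applied to the restriction of [d], so the isometry
    [mxnorm_inv_mulmx] applies to that submatrix. *)
Lemma mxnorm_inv_submat {R : rcfType} {n : nat} {B : 'M[R]_n}
    (U : {set 'I_n}) (d : 'cV[R]_n) :
  posdefmx B -> (forall i, i \notin U -> d i 0 = 0) ->
  mxnorm (invmx (submat B U U)) (subvec (B *m d) U) = mxnorm B d.
Proof.
move=> pdB /restrmx_trK dE.
have -> : subvec (B *m d) U = submat B U U *m subvec d U.
  by rewrite submatE -!mulmxA dE subvecE.
rewrite mxnorm_inv_mulmx; last exact: posdefmx_submat.
by rewrite /mxnorm -[in RHS]dE submatE trmx_mul trmxK !mulmxA.
Qed.

Lemma mulmx_disjoint_supp {R : rcfType} {n : nat} (U : {set 'I_n})
    (d g : 'cV[R]_n) :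
  (forall i, i \notin U -> d i 0 = 0) -> (forall i, i \in U -> g i 0 = 0) ->
  d^T *m g = 0.
Proof.
move=> d0 g0; apply/matrixP => i j; rewrite !ord1 !mxE big1 // => l _.
rewrite mxE; have [lU | lNU] := boolP (l \in U).
  by rewrite g0 // mulr0.
by rewrite d0 // mul0r.
Qed.

(** * Active sets *)

Lemma solution_inactive {R : rcfType} {n : nat} {A : 'M[R]_n}
    {b phi us lams : 'cV[R]_n} (i : 'I_n) :
  is_solution A b phi us lams -> i \notin active_set phi us lams ->
  lams i 0 = 0.
Proof.
case=> _ /eqP; rewrite subr_eq0 => /eqP lamsE.
by rewrite inE -leNgt {2}lamsE !mxE => /max_idPl.
Qed.

Lemma HIK_lam_inactive {R : rcfType} {n : nat} {A : 'M[R]_n}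
    {b phi u0 : 'cV[R]_n} {u lam : nat -> 'cV[R]_n}
    {act : nat -> {set 'I_n}} {k : nat} {i : 'I_n} :
  HIK A b phi u0 u lam act -> i \notin act k -> lam k.+1 i 0 = 0.
Proof.
move=> alg iNA; have := HIK_eq_inactive alg k.
rewrite -[0](_ : subvec 0 _ = 0); last by apply/colP => j; rewrite !mxE.
by move/eqP/subvec_eqP/(_ i); rewrite inE iNA mxE; apply.
Qed.

(** An index of [act k.+1] was already in [act k], where [u k.+1] is set to
    [phi]: otherwise [lam k.+1 i 0 = 0], and being active would mean
    [u k.+1 i 0 > phi i 0]. *)
Lemma HIK_u_on_act {R : rcfType} {n : nat} {A : 'M[R]_n}
    {b phi u0 : 'cV[R]_n} {u lam : nat -> 'cV[R]_n}
    {act : nat -> {set 'I_n}} {k : nat} {i : 'I_n} :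
  HIK A b phi u0 u lam act -> u k.+1 i 0 <= phi i 0 -> i \in act k.+1 ->
  u k.+1 i 0 = phi i 0.
Proof.
move=> alg u_le; rewrite (HIK_actS alg) inE => i_act.
have [iA | iNA] := boolP (i \in act k).
  by have /eqP/subvec_eqP := HIK_eq_active alg k; apply.
by move: i_act; rewrite (HIK_lam_inactive alg iNA) add0r subr_gt0 ltNge u_le.
Qed.

Theorem theorem5p3 (R : rcfType) (N : nat) (A : 'M[R]_N)
    (b phi us lams u0 : 'cV[R]_N)
    (u lam : nat -> 'cV[R]_N) (act : nat -> {set 'I_N}) (k : nat)
    (A_posdef : posdefmx A)
    (sol : is_solution A b phi us lams)
    (alg : HIK A b phi u0 u lam act)
    (k_ge1 : (1 <= k)%N)
    (act_sub : active_set phi us lams \subset act k)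
    (u_le_phi : forall i : 'I_N, u k i 0 <= phi i 0) :
  mxnorm A (u k.+1 - us) ^+ 2 - mxnorm A (u k - us) ^+ 2
    + mxnorm (invmx (submat A (~: act k) (~: act k)))
             (subvec (lam k) (~: act k)) ^+ 2 = 0
  /\ (u k != us ->
      mxnorm A (u k.+1 - us) / mxnorm A (u k - us)
        = mxnorm (invmx A) (lam k.+1 - lams) / mxnorm (invmx A) (lam k - lams)
      /\ mxnorm (invmx A) (lam k.+1 - lams) / mxnorm (invmx A) (lam k - lams)
        = rho A lams (~: act k) (lam k)).
Proof.
(* The active-set argument compares [act k] with its predecessor. *)
case: k k_ge1 act_sub u_le_phi => // k _ act_sub u_le_phi.
set I := ~: act k.+1.
set d := u k.+2 - u k.+1.
have AuE j : A *m u j.+1 = b - lam j.+1 by rewrite -(HIK_eq alg j) addrK.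
have dual_error j : lam j.+1 - lams = - (A *m (u j.+1 - us)).
  by rewrite mulmxBr AuE -sol.1 !opprB addrCA opprD addNKr.
have lam0 i : i \in I -> lam k.+2 i 0 = 0.
  by rewrite inE; apply: HIK_lam_inactive alg.
have d_supp i : i \notin I -> d i 0 = 0.
  rewrite inE negbK => iA; rewrite !mxE (HIK_u_on_act alg (u_le_phi i) iA).
  have /eqP/subvec_eqP -> // := HIK_eq_active alg k.+1.
  by rewrite subrr.
have orth : d^T *m A *m (u k.+2 - us) = 0.
  rewrite -mulmxA -[A *m _]opprK -dual_error.
  apply: (mulmx_disjoint_supp I) => // i iI; rewrite !mxE lam0 //.
  rewrite (solution_inactive i sol) ?subr0 ?oppr0 //.
  by apply: contraTN iI => /(subsetP act_sub); rewrite inE negbK.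
have lamI : subvec (lam k.+1) I = subvec (A *m d) I.
  apply/eqP/subvec_eqP => i iI.
  have -> : A *m d = lam k.+1 - lam k.+2.
    by rewrite mulmxBr !AuE opprB addrC addrA subrK.
  by rewrite !mxE lam0 // subr0.
have pyth : mxnorm A (u k.+1 - us) ^+ 2 = mxnorm A (u k.+2 - us) ^+ 2
    + mxnorm (invmx (submat A I I)) (subvec (lam k.+1) I) ^+ 2.
  rewrite lamI mxnorm_inv_submat // -mxnorm_pythagoras //.
  by congr (mxnorm A _ ^+ 2); rewrite opprB [RHS]addrC addrA subrK.
have dual_norm j : mxnorm (invmx A) (lam j.+1 - lams) = mxnorm A (u j.+1 - us).
  by rewrite dual_error mxnormN mxnorm_inv_mulmx.
split=> [|u_neq]; first by rewrite pyth opprD addrA subrr sub0r addNr.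
rewrite /rho !dual_norm; split=> //.
have e_gt0 : 0 < mxnorm A (u k.+1 - us) by rewrite mxnorm_gt0 // subr_eq0.
have -> : mxnorm (invmx (submat A I I)) (subvec (lam k.+1) I) ^+ 2
    = mxnorm A (u k.+1 - us) ^+ 2 - mxnorm A (u k.+2 - us) ^+ 2.
  by rewrite pyth addrC addKr.
rewrite mulrBl divff ?expf_neq0 ?gt_eqF // subKr -expr_div_n.
by rewrite sqrtr_sqr ger0_norm // divr_ge0 ?sqrtr_ge0.
Qed.
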